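(* Let $M\in\mathbb{N}$, let $w_1,w_{21},w_{22}\in\mathbb{N}$ with $\frac{2\pi}{w_{22}}<\frac{2\pi}{w_{21}}\le\frac{2\pi}{w_1}$, and let $f_1:\mathbb{R}\to\mathbb{R}$ be a differentiable function that is periodic with cycle length $\frac{2\pi}{w_1}$ (so $f_1'$ is defined everywhere). Let $T$ be a nonempty finite subset of $[0,\frac{2\pi}{w_1}]$. Put $\tau_1=\frac{2\pi}{w_{21}(M+1)}$, $\tau_2=\frac{2\pi}{w_{22}(M+1)}$, and \[X_j=\{\big(f_1(t),f_1(t+\tau_j),\dots,f_1(t+M\tau_j)\big)^T : t\in T\}\subset\mathbb{R}^{M+1},\quad j=1,2.\] Let $\mathrm{dgm}_1(X_j)$ be the 1-dimensional persistence diagram of the Vietoris–Rips filtration on $X_j$ (Euclidean metric), $\mathrm{mp}(\mathrm{dgm}_1(X_j))$ the maximum persistence (death minus birth) of a point of this diagram, and $\mathrm{score}(f_1|f_{2j})=\mathrm{mp}(\mathrm{dgm}_1(X_j))/\sqrt{3}$. Write $\Delta=\left|\frac{2\pi}{w_{21}}-\frac{2\pi}{w_{22}}\right|$. Then there exist $t\in T$ and points $c_i\in(t+(i-1)\tau_2,\,t+(i-1)\tau_1)$, $i=2,\dots,M+1$, such that, with $S=\sqrt{\sum_{i=2}^{M+1}|f_1'(c_i)|^2}$, \begin{align*} d_H(X_1,X_2)&\le \sqrt{M+1}\,\Delta\, S,\\ d_B(\mathrm{dgm}_1(X_1),\mathrm{dgm}_1(X_2))&\le 2\sqrt{M+1}\,\Delta\,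 S,\\ |\mathrm{mp}(\mathrm{dgm}_1(X_1))-\mathrm{mp}(\mathrm{dgm}_1(X_2))|&\le 4\sqrt{M+1}\,\Delta\, S,\\ |\mathrm{score}(f_1|f_{21})-\mathrm{score}(f_1|f_{22})|&\le 4\sqrt{\tfrac{M+1}{3}}\,\Delta\, S. \end{align*}
   Context: $d_H$ is the Hausdorff distance between subsets of $\mathbb{R}^{M+1}$: $d_H(X,Y)=\inf\{\epsilon>0: X\subseteq Y^\epsilon, Y\subseteq X^\epsilon\}$, where $X^\epsilon$ is the union of open $\epsilon$-balls about points of $X$. $d_B$ is the bottleneck distance: $d_B(D,D')=\inf_\phi\sup_x\|x-\phi(x)\|_\infty$ over bijections $\phi$ between the diagrams (each augmented by points of the diagonal). The set $X_j$ is the ''conditional sliding windows embedding'' of $f_1$ given a series $f_{2j}$ of cycle length $\frac{2\pi}{w_{2j}}$, and $\mathrm{score}(f_1|f_{2j})$ its ''conditional periodicity score''. *)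

(* Defs.v *)
From HB Require Import structures.
From mathcomp Require Import all_boot all_order all_algebra.
From mathcomp Require Import all_classical all_reals all_analysis.

Set Implicit Arguments.
Unset Strict Implicit.
Unset Printing Implicit Defensive.

Import Order.TTheory GRing.Theory Num.Theory.
Local Open Scope ring_scope.
Local Open Scope classical_set_scope.

Section VRPersistence.
Variable R : realType.

Definition edist (n : nat) (u v : 'rV[R]_n) : R :=
  Num.sqrt (\sum_(i < n) (u ord0 i - v ord0 i) ^+ 2).

(* Vertices of the VR complex of a point cloud P are indices 'I_(size P).
   Simplices are nonempty subsets; the filtration value of a simplex is its
   diameter. *)
Definition vr_diam (n : nat) (P : seq 'rV[R]_n) (A : {set 'I_(size P)}) : R :=
  \big[Num.max/0]_(i in A) \big[Num.max/0]_(j in A)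
     edist (nth 0 P i) (nth 0 P j).

(* Chains are indexed by all subsets of vertices (coefficients in F_2);
   p-chains are supported on subsets of size p+1. *)
Definition nsets (n : nat) (P : seq 'rV[R]_n) := #|{: {set 'I_(size P)}}|.

Definition sset (n : nat) (P : seq 'rV[R]_n) (i : 'I_(nsets P)) :
  {set 'I_(size P)} := enum_val i.

Definition bdmx (n : nat) (P : seq 'rV[R]_n) : 'M['F_2]_(nsets P) :=
  \matrix_(i, j) ([&& @sset n P j \subset @sset n P i,
                      #|@sset n P i| == #|@sset n P j|.+1 & (0 < #|@sset n P j|)%N] : bool)%:R.

Definition selmx (n : nat) (P : seq 'rV[R]_n) (p : nat) (r : R) :
  'M['F_2]_(nsets P) :=
  diag_mx (\row_i ((#|@sset n P i| == p.+1) && (vr_diam (@sset n P i) <= r) : bool)%:R).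

Definition cycles1 (n : nat) (P : seq 'rV[R]_n) (r : R) :=
  kermx (row_mx (bdmx P) (1%:M - selmx P 1 r)).

Definition bounds1 (n : nat) (P : seq 'rV[R]_n) (s : R) :=
  selmx P 2 s *m bdmx P.

(* persistent Betti number: rank of H_1(VR_r) -> H_1(VR_s), r <= s *)
Definition pbetti1 (n : nat) (P : seq 'rV[R]_n) (r s : R) : nat :=
  (\rank (cycles1 P r) - \rank (cycles1 P r :&: bounds1 P s)%MS)%N.

Definition critvals (n : nat) (P : seq 'rV[R]_n) : seq R :=
  sort <=%R (undup [seq edist x y | x <- P, y <- P]).

Definition pb_idx (n : nat) (P : seq 'rV[R]_n) (a b : nat) : int :=
  (pbetti1 P (critvals P)`_a (critvals P)`_b)%:Z.

Definition mult1 (n : nat) (P : seq 'rV[R]_n) (a b : nat) : int :=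
  pb_idx P a b.-1
  - (if a is a'.+1 then pb_idx P a' b.-1 else 0)
  - pb_idx P a b
  + (if a is a'.+1 then pb_idx P a' b else 0).

Definition dgm1_seq (n : nat) (P : seq 'rV[R]_n) : seq (R * R) :=
  let cv := critvals P in
  flatten [seq nseq `|mult1 P ab.1 ab.2|%N (cv`_(ab.1), cv`_(ab.2))
          | ab <- [seq ab <- [seq (a, b) | a <- iota 0 (size cv),
                                          b <- iota 0 (size cv)]
                  | (ab.1 < ab.2)%N]].

Definition dgm1 (n : nat) (P : seq 'rV[R]_n) : seq (R * R) :=
  dgm1_seq (undup P).

Definition maxpers (D : seq (R * R)) : R :=
  \big[Num.max/0]_(p <- D) (p.2 - p.1).

(* diagram augmented by every diagonal point with countably infinite
   multiplicity *)
Definition aug (D : seq (R * R)) := ('I_(size D) + (R * nat))%type.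

Definition aug_pt (D : seq (R * R)) (x : aug D) : R * R :=
  match x with
  | inl i => nth (0, 0) D i
  | inr (a, _) => (a, a)
  end.

Definition linf (p q : R * R) : R :=
  Num.max `|p.1 - q.1| `|p.2 - q.2|.

Definition bottleneck (D D' : seq (R * R)) : \bar R :=
  ereal_inf [set ereal_sup [set (linf (aug_pt x) (aug_pt (phi x)))%:E
                            | x in [set: aug D]]
            | phi in [set phi : aug D -> aug D' | bijective phi]].

Definition thick (n : nat) (Y : set 'rV[R]_n) (e : R) : set 'rV[R]_n :=
  [set x | exists2 y, Y y & edist x y < e].

Definition hausdorff (n : nat) (X Y : set 'rV[R]_n) : \bar R :=
  ereal_inf [set e%:E | e in [set e : R | 0 < e /\ X `<=` thick Y e
                                         /\ Y `<=` thick X e]].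

Definition swe (M : nat) (f : R -> R) (tau t : R) : 'rV[R]_(M.+1) :=
  \row_(i < M.+1) f (t + i%:R * tau).

End VRPersistence.

(* Main.v *)
Require Import Defs.
From HB Require Import structures.
From mathcomp Require Import all_boot all_order all_algebra.
From mathcomp Require Import all_classical all_reals all_analysis.
From mathcomp Require Import ssrAC zify ring lra.

(** By the mean value theorem the two embeddings of each t in T are at distance
    at most Delta * S, where t is chosen to maximise that distance; this bounds
    the Hausdorff distance, and the pairwise distances change by at most twice
    as much.  It remains to prove bottleneck stability for the Rips filtration
    under a perturbation of the (pseudo-)metric on a fixed index set.

    The multiplicity of a point (x, y) of the diagram is an alternating sum of
    the four Betti numbers b(G, H), the rank of H_1(Cl G) -> H_1(Cl H), where G
    and H are the graphs of pairs at distance <= x or < x, and <= y or < y.  By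
    submodularity of b it is nonnegative.  If two weight functions on the pairs
    never order two pairs in opposite ways, both diagrams are images of a single
    combinatorial diagram, up to points on the diagonal, and matching the images
    moves points by at most the sup distance of the weights.  In general,
    interpolate linearly between the two weight functions; each pair of pairs
    changes order at most once on the way, so finitely many steps suffice. *)

Set Implicit Arguments.
Unset Strict Implicit.
Unset Printing Implicit Defensive.

Import Order.TTheory GRing.Theory Num.Theory.
Local Open Scope ring_scope.

(** * First homology of clique complexes over F_2 *)

Section CliqueHomology.
Variable n : nat.
Local Notation V := 'I_n.
Local Notation N := #|{: {set V}}|.
Implicit Types (u v w : V) (G H : {set V * V}) (A : {set V}).

Definition vset (i : 'I_N) : {set V} := enum_val i.

Definition bdry : 'M['F_2]_N :=
  \matrix_(i, j) ([&& vset j \subset vset i,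
                      #|vset i| == #|vset j|.+1 & (0 < #|vset j|)%N] : bool)%:R.

Definition clique G A := [forall u in A, forall v in A, (u, v) \in G].

Definition selc (p : nat) G : 'M['F_2]_N :=
  diag_mx (\row_i ((#|vset i| == p.+1) && clique G (vset i) : bool)%:R).

(** Chains are row vectors. The first block makes the boundary vanish; the second makes [selc 1 G]
    fix the chain, which confines it to edges of the clique complex. *)
Definition cyc G := kermx (row_mx bdry (1%:M - selc 1 G)).
Definition bnd H := selc 2 H *m bdry.
Definition betti G H : nat := (\rank (cyc G) - \rank (cyc G :&: bnd H)%MS)%N.

Lemma cliqueP G A :
  reflect (forall u v, u \in A -> v \in A -> (u, v) \in G) (clique G A).
Proof.
apply: (iffP (forall_inPP _ (fun u => forall_inP))).
  by move=> h u v uA vA; exact: h.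
by move=> h u uA v vA; exact: h.
Qed.

Lemma cliqueS G H A : G \subset H -> clique G A -> clique H A.
Proof.
move=> sGH /cliqueP h; apply/cliqueP => u v uA vA.
by apply: (fintype.subsetP sGH); apply: h.
Qed.

Lemma sub_cyc m (z : 'M['F_2]_(m, N)) G :
  (z <= cyc G)%MS = (z *m bdry == 0) && (z == z *m selc 1 G).
Proof.
rewrite sub_kermx mul_mx_row row_mx_eq0; congr (_ && _).
by rewrite mulmxBr mulmx1 subr_eq0.
Qed.

Lemma selc_mulS p G H : G \subset H -> selc p G *m selc p H = selc p G.
Proof.
move=> sGH; rewrite /selc mulmx_diag; congr diag_mx; apply/rowP => i.
rewrite !mxE; case: (_ == _) => /=; last by rewrite mul0r.
have [c|] := boolP (clique G (vset i)); last by rewrite mul0r.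
by rewrite (cliqueS sGH c) mulr1.
Qed.

Lemma cycS G H : G \subset H -> (cyc G <= cyc H)%MS.
Proof.
move=> sGH; have := submx_refl (cyc G); rewrite !sub_cyc => /andP[->] /eqP e /=.
by rewrite {2}e -mulmxA selc_mulS // -e.
Qed.

Lemma bndS G H : G \subset H -> (bnd G <= bnd H)%MS.
Proof. by move=> sGH; rewrite /bnd -(selc_mulS 2 sGH) -mulmxA submxMl. Qed.

(** Rank-nullity for the quotient by boundaries. Written as the rank of a product, the Betti number
    can be compared along chain maps. *)
Lemma betti_coker G H : betti G H = \rank (cyc G *m cokermx (bnd H)).
Proof.
rewrite /betti -[X in (X - _)%N](mxrank_mul_ker (cyc G) (cokermx (bnd H))).
have e : (kermx (cokermx (bnd H)) :=: bnd H)%MS.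
  apply/eqmxP/andP; split; last by rewrite sub_kermx mulmx_coker.
  by rewrite submxE mulmx_ker.
by rewrite (cap_eqmx (eqmx_refl _) e).1 addnK.
Qed.

(** Matches the convention of [mult1], which puts 0 in place of Betti numbers before the first
    critical value. *)
Lemma betti0 H : betti finset.set0 H = 0%N.
Proof.
rewrite /betti; suff -> : cyc finset.set0 = 0 by rewrite mxrank0 sub0n.
have := submx_refl (cyc finset.set0); rewrite sub_cyc => /andP[_] /eqP ->.
suff -> : selc 1 finset.set0 = 0 by rewrite mulmx0.
apply/matrixP => i j; rewrite !mxE.
case: (altP (#|vset i| =P 2%N)) => [|_] /=; last by rewrite mul0rn.
move=> /eqP /cards2P [u [v [uv ->]]].
case: cliqueP => [h|_]; last by rewrite mul0rn.
by have := h u v; rewrite !inE !eqxx orbT => /(_ isT isT).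
Qed.

(** The ranks of the cycle spaces cancel. What remains is the dimension formula for
    [cyc G' :&: bnd H] and [cyc G :&: bnd H']: their sum lies in [cyc G' :&: bnd H'], their
    intersection in [cyc G :&: bnd H]. *)
Lemma betti_submod G G' H H' : G \subset G' -> H \subset H' ->
  (betti G H + betti G' H' <= betti G' H + betti G H')%N.
Proof.
move=> sG sH.
have zG := cycS sG; have bH := bndS sH.
pose c G H := \rank (cyc G :&: bnd H)%MS.
have le K L : (c K L <= \rank (cyc K))%N by apply/mxrankS/capmxSl.
have main : (c G' H + c G H' <= c G' H' + c G H)%N.
  rewrite /c -mxrank_sum_cap leq_add //; apply: mxrankS.
    by rewrite addsmx_sub !capmxS.
  rewrite sub_capmx (submx_trans (capmxSr _ _) (capmxSl _ _)).
  by rewrite (submx_trans (capmxSl _ _) (capmxSr _ _)).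
(* These bounds make the truncated subtractions in [betti] exact. *)
have := le G H; have := le G' H; have := le G H'; have := le G' H'.
move: main; rewrite /betti -/(c G H) -/(c G' H) -/(c G H') -/(c G' H'); lia.
Qed.

Definition vertex u : 'rV['F_2]_N := delta_mx 0 (enum_rank [set u]).

(** Degenerate edges are zero, so a vertex map that collapses edges still induces a chain map. *)
Definition edge u v : 'rV['F_2]_N :=
  if u == v then 0 else delta_mx 0 (enum_rank [set u; v]).

Lemma F2addr m p (x : 'M['F_2]_(m, p)) : x + x = 0.
Proof.
apply/matrixP => i j; rewrite !mxE; move: (x i j) => {}x.
by apply/val_inj; case: x => [[|[|]]].
Qed.

Lemma edgeC u v : edge u v = edge v u.
Proof. by rewrite /edge eq_sym finset.setUC. Qed.

Lemma edge_bdry u v : edge u v *m bdry = vertex u + vertex v.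
Proof.
rewrite /edge; have [->|uv] := eqVneq; first by rewrite mul0mx F2addr.
rewrite -rowE; apply/rowP => j; rewrite !mxE !eqxx /= /vset enum_rankK.
rewrite -!(can2_eq (@enum_valK _) (@enum_rankK _)).
set A := enum_val j; rewrite cards2 uv.
have [->|Au] := eqVneq A [set u].
  rewrite finset.sub1set finset.cards1 !inE eqxx /=.
  have -> : [set u] == [set v] = false.
    by apply/negP => /eqP /setP /(_ u); rewrite !inE eqxx (negbTE uv).
  by rewrite addr0.
have [->|Av] := eqVneq A [set v].
  by rewrite finset.sub1set finset.cards1 !inE eqxx orbT /= add0r.
rewrite addr0; case: eqP => [|]; last by rewrite andbF.
move=> [] /esym/eqP/cards1P [w Aw]; move: Au Av; rewrite Aw finset.sub1set !inE.
have [->|wu] := eqVneq w u; first by rewrite eqxx.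
by have [->|//] := eqVneq w v; rewrite eqxx.
Qed.

(** The boundary of a triangle, spelled out in edges so that it makes sense for repeated vertices,
    where it vanishes. *)
Definition tri u v w := edge u v + edge v w + edge u w.

Lemma tri_bdry u v w : u != v -> v != w -> u != w ->
  (delta_mx 0 (enum_rank [set u; v; w]) : 'rV['F_2]_N) *m bdry = tri u v w.
Proof.
move=> uv vw uw; rewrite /tri /edge (negbTE uv) (negbTE vw) (negbTE uw).
rewrite -rowE; apply/rowP => j; rewrite !mxE !eqxx /= /vset enum_rankK.
rewrite -!(can2_eq (@enum_valK _) (@enum_rankK _)).
set A := enum_val j.
have c3 : #|[set u; v; w]| = 3%N.
  rewrite -finset.setUA cardsU1 cards2 vw !inE negb_or uv uw //.
rewrite c3.
have [A2|A2] := altP (3%N =P #|A|.+1); last first.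
  rewrite andbF; case: eqP => [e|_].
    by rewrite e cards2 uv in A2.
  case: eqP => [e|_]; first by rewrite e cards2 vw in A2.
  case: eqP => [e|_]; first by rewrite e cards2 uw in A2.
  by rewrite !addr0.
case: A2 => /esym/eqP/cards2P [a [b [ab Aab]]].
rewrite Aab cards2 ab !andbT.
(* Equality of unordered pairs becomes a condition on vertices, which leaves a finite case
   analysis. *)
have sE x y : ([set a; b] == [set x; y]) =
    [|| (a == x) && (b == y), (a == y) && (b == x) | [&& x == y, a == x & b == x]].
  apply/eqP/idP => [/setP e|].
    have := e a; have := e b; have := e x; have := e y; rewrite !inE !eqxx !orbT /= .
    do ![case: eqVneq => //= ?; subst => //=]; rewrite ?eqxx ?orbT //=; try by [].
  case/or3P => [/andP[/eqP-> /eqP->] //|/andP[/eqP-> /eqP->]|/and3P[/eqP-> /eqP-> /eqP->] //].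
  by rewrite finset.setUC.
rewrite !sE (negbTE uv) (negbTE vw) (negbTE uw) /= !orbF.
rewrite finset.subUset !finset.sub1set !inE.
move: ab uv vw uw.
do ![case: eqVneq => //= ?; subst => //=]; rewrite ?eqxx //= ?addr0 ?add0r;
  try (match goal with h : is_true (?x != ?x) |- _ => by rewrite eqxx in h end);
  by move=> *; apply/val_inj.
Qed.

Lemma tri_bnd u v w H : (forall a b, a \in [set u; v; w] -> b \in [set u; v; w] -> (a, b) \in H) ->
  (tri u v w <= bnd H)%MS.
Proof.
move=> /cliqueP h.
have [uv|uv] := eqVneq u v.
  by rewrite /tri /edge uv eqxx add0r F2addr sub0mx.
have [vw|vw] := eqVneq v w.
  by rewrite /tri /edge vw eqxx addr0 F2addr sub0mx.
have [uw|uw] := eqVneq u w.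
  by rewrite /tri uw (edgeC w) F2addr add0r /edge eqxx sub0mx.
rewrite -tri_bdry // /bnd.
set i := enum_rank _; suff -> : (delta_mx 0 i : 'rV['F_2]_N) = row i (selc 2 H).
  by rewrite -row_mul row_sub.
rewrite row_diag_mx mxE /vset enum_rankK h.
by rewrite -finset.setUA cardsU1 cards2 vw !inE negb_or uv uw /= scale1r.
Qed.

(** Reduction to generators: a linear condition on edge chains need only be checked on single edges.
    With [W] zero it proves identities between linear maps. *)
Lemma selc1_sub m K (X : 'M['F_2]_(N, K)) (W : 'M['F_2]_(m, K)) G :
  (forall u v, u != v -> (forall a b, a \in [set u; v] -> b \in [set u; v] -> (a, b) \in G) ->
     (edge u v *m X <= W)%MS) ->
  (selc 1 G *m X <= W)%MS.
Proof.
move=> h; apply/row_subP => i; rewrite row_mul row_diag_mx mxE.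
case: (altP (#|vset i| =P 2%N)) => [|_] /=; last by rewrite scale0r mul0mx sub0mx.
move=> /eqP /cards2P [u [v [uv e]]].
case: cliqueP => [c|_]; last by rewrite scale0r mul0mx sub0mx.
rewrite e in c; have := h u v uv c; rewrite /edge (negbTE uv) scale1r.
by rewrite -e enum_valK.
Qed.

Lemma bnd_sub m K (X : 'M['F_2]_(N, K)) (W : 'M['F_2]_(m, K)) H :
  (forall u v w, (forall a b, a \in [set u; v; w] -> b \in [set u; v; w] -> (a, b) \in H) ->
     (tri u v w *m X <= W)%MS) ->
  (bnd H *m X <= W)%MS.
Proof.
move=> h; apply/row_subP => i; rewrite row_mul /bnd row_mul row_diag_mx mxE.
case: (altP (#|vset i| =P 3%N)) => [|_] /=; last by rewrite scale0r !mul0mx sub0mx.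
move=> c3.
case: cliqueP => [c|_]; last by rewrite scale0r !mul0mx sub0mx.
have /card_gt0P[u uA] : (0 < #|vset i|)%N by rewrite c3.
have /eqP : #|vset i :\ u| = 2%N by move: c3; rewrite (cardsD1 u (vset i)) uA => -[].
case/cards2P => v [w [vw e]].
have eA : vset i = [set u; v; w] by rewrite -finset.setUA -e finset.setD1K.
have [uv uw] : u != v /\ u != w.
  have := finset.in_setD1 u (vset i) u; rewrite e eqxx !inE => /negbT.
  by rewrite negb_or => /andP.
rewrite scale1r -[i]enum_valK -/(vset i) eA tri_bdry //.
by apply: h; rewrite -eA.
Qed.

(** A two-element set does not order its vertices; symmetry of [phi] makes the pair chosen by [pick]
    irrelevant, and [phi u u = 0] agrees with degenerate edges. *)
Lemma edge_ext K (phi : V -> V -> 'rV['F_2]_K) :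
  (forall u v, phi u v = phi v u) -> (forall u, phi u u = 0) ->
  {X : 'M['F_2]_(N, K) | forall u v, edge u v *m X = phi u v}.
Proof.
move=> phiC phi0.
exists (\matrix_i (if [pick uv | (uv.1 != uv.2) && (vset i == [set uv.1; uv.2])] is Some uv
                  then phi uv.1 uv.2 else 0)) => u v.
rewrite /edge; have [->|uv] := eqVneq; first by rewrite mul0mx phi0.
rewrite -rowE rowK /vset enum_rankK; case: pickP => [[a b] /= /andP[ab /eqP /setP e]|/(_ (u, v))].
  have := e a; have := e b; have := e u; have := e v; rewrite !inE !eqxx !orbT /=.
  move: uv ab; do ![case: eqVneq => //= ?; subst => //=].
by rewrite /= uv eqxx.
Qed.

Lemma vertex_ext K (psi : V -> 'rV['F_2]_K) :
  {X : 'M['F_2]_(N, K) | forall u, vertex u *m X = psi u}.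
Proof.
exists (\matrix_i (if [pick u | vset i == [set u]] is Some u
                  then psi u else 0)) => u.
rewrite -rowE rowK /vset enum_rankK; case: pickP => [a /eqP/setP/(_ u)|/(_ u)].
  by rewrite !inE eqxx => /esym/eqP->.
by rewrite eqxx.
Qed.

End CliqueHomology.

(** * Invariance of ranks under contiguous simplicial maps *)

Section Contiguity.
Variables (n n' : nat) (f : 'I_n -> 'I_n') (g : 'I_n' -> 'I_n).
Variables (G H : {set 'I_n * 'I_n}) (G' H' : {set 'I_n' * 'I_n'}).
Hypothesis sGH : G \subset H.
Hypothesis fG : forall u v, (u, v) \in G -> (f u, f v) \in G'.
Hypothesis gH : forall u v, (u, v) \in H' -> (g u, g v) \in H.
Hypothesis gfr : forall u v, (u, v) \in H -> (u, g (f v)) \in H.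
Hypothesis gfl : forall u v, (u, v) \in H -> (g (f u), v) \in H.

Let psh m m' (h : 'I_m -> 'I_m') :
  {X | forall u v, edge u v *m X = edge (h u) (h v)}.
Proof.
by apply: edge_ext => [u v|u]; [exact: edgeC|rewrite /edge eqxx].
Qed.

Let F := sval (psh f).
Let K := sval (psh g).
Let FE u v : edge u v *m F = edge (f u) (f v). Proof. exact: (svalP (psh f)). Qed.
Let KE u v : edge u v *m K = edge (g u) (g v). Proof. exact: (svalP (psh g)). Qed.

Let cycF : (cyc G *m F <= cyc G')%MS.
Proof.
(* [F0] is the degree 0 part of the chain map whose degree 1 part is [F]. *)
have [F0 F0E] := vertex_ext (fun u => vertex (f u)).
have bF : selc 1 G *m (F *m bdry n' - bdry n *m F0) = 0.
  apply/eqP; rewrite -submx0; apply: selc1_sub => u v _ _.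
  rewrite mulmxBr mulmxA FE edge_bdry mulmxA edge_bdry mulmxDl !F0E subrr.
  exact: sub0mx.
have sF : selc 1 G *m F = selc 1 G *m F *m selc 1 G'.
  apply/eqP; rewrite -subr_eq0 -mulmxA -mulmxBr -submx0; apply: selc1_sub.
  move=> u v _ c; rewrite mulmxBr mulmxA FE submx0 subr_eq0.
  have [e|fuv] := eqVneq (f u) (f v); first by rewrite /edge e eqxx mul0mx.
  rewrite /edge (negbTE fuv) -rowE row_diag_mx mxE /vset enum_rankK cards2 fuv.
  case: cliqueP => [|[]]; first by rewrite scale1r.
  move=> a b; rewrite !inE => aA bA;
  by case/orP: aA => /eqP->; case/orP: bA => /eqP->; apply: fG; apply: c;
    rewrite !inE eqxx ?orbT.
have := submx_refl (cyc G); rewrite !sub_cyc => /andP[/eqP zb /eqP zs].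
apply/andP; split; last first.
  have := congr1 (mulmx (cyc G)) sF; rewrite !mulmxA -zs => /eqP.
  by apply.
move: bF => /(congr1 (mulmx (cyc G))); rewrite mulmx0 mulmxA -zs mulmxBr.
by rewrite !mulmxA zb mul0mx subr0 => ->.
Qed.

Let bndK : (bnd H' *m K <= bnd H)%MS.
Proof.
apply: bnd_sub => u v w c; rewrite !mulmxDl !KE; apply: tri_bnd => a b.
rewrite !inE => aA bA.
by case/orP: aA => [/orP[]|] /eqP->; case/orP: bA => [/orP[]|] /eqP->;
  apply: gH; apply: c; rewrite !inE eqxx ?orbT.
Qed.

(* The prism over an edge uv with opposite edge u'v', u' = g (f u), is filled
   by the triangles u v v' and u u' v'. *)
Let homotopy : (cyc G *m (1%:M - F *m K) <= bnd H)%MS.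
Proof.
(* Adding [bdry n *m Q] changes nothing on cycles, but it makes the inclusion true edge by edge. *)
have [Q QE] := vertex_ext (fun u => edge u (g (f u))).
have := submx_refl (cyc G); rewrite sub_cyc => /andP[/eqP zb /eqP zs].
have -> : cyc G *m (1%:M - F *m K) = cyc G *m (1%:M + F *m K + bdry n *m Q).
  rewrite !mulmxDr mulmxN (mulmxA _ (bdry n)) zb mul0mx addr0; congr (_ + _).
  by apply/eqP; rewrite eq_sym -subr_eq0 opprK F2addr.
rewrite zs -mulmxA; apply: (submx_trans (submxMl _ _)).
apply: selc1_sub => u v _ c.
rewrite !mulmxDr mulmx1 (mulmxA _ F) FE KE (mulmxA _ (bdry n)) edge_bdry mulmxDl !QE.
set u' := g (f u); set v' := g (f v).
have -> : edge u v + edge u' v' + (edge u u' + edge v v') =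
          tri u v v' + tri u u' v'.
  rewrite /tri; set a := edge u v; set b := edge u' v'; set p := edge u u'.
  set q := edge v v'; set r := edge u v'.
  (* The diagonal [r] lies in both triangles and cancels over F_2. *)
  by rewrite [RHS](AC (3*3) (1*5*(4*2)*(3*6))) /= F2addr addr0.
have c' a b : a \in [set u; v] -> b \in [set u; v] -> (a, b) \in H.
  by move=> aA bA; apply: (fintype.subsetP sGH); apply: c.
have in1 : u \in [set u; v] by rewrite !inE eqxx.
have in2 : v \in [set u; v] by rewrite !inE eqxx orbT.
apply: addmx_sub; apply: tri_bnd => a b; rewrite !inE => aA bA;
by case/orP: aA => [/orP[]|] /eqP->; case/orP: bA => [/orP[]|] /eqP->;
  do ?[apply: gfr | apply: gfl]; apply: c'.
Qed.

(** Since [g \o f] is homotopic to the identity, H_1(Cl G) -> H_1(Cl H) factors through H_1(Cl G')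
    -> H_1(Cl H'), so its rank cannot be larger. *)
Lemma betti_contiguous : (betti G H <= betti G' H')%N.
Proof.
rewrite !betti_coker; set C := cokermx (bnd H); set C' := cokermx (bnd H').
have -> : cyc G *m C = cyc G *m F *m (K *m C).
  apply/eqP; rewrite -subr_eq0 -mulmxA -mulmxBr (mulmxA F) -[X in X - _]mul1mx.
  by rewrite -mulmxBl mulmxA -submxE homotopy.
apply: leq_trans (mxrankS (submxMr C' cycF)).
(* By rank-nullity on the image of [F], it suffices that the kernel of [C'], which is [bnd H'], is
   killed by [K *m C]. *)
rewrite -(leq_add2r (\rank (cyc G *m F :&: kermx C'))) mxrank_mul_ker.
rewrite -[X in (_ <= X)%N](mxrank_mul_ker (cyc G *m F) (K *m C)).
rewrite leq_add2l; apply/mxrankS/capmxS => //.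
rewrite sub_kermx mulmxA -submxE.
have kB : (kermx C' <= bnd H')%MS by rewrite submxE mulmx_ker.
exact: submx_trans (submxMr K kB) bndK.
Qed.

End Contiguity.

(* all_analysis exports another edist, on pairs, which shadows the one of Defs. *)
Local Notation edist := Defs.edist.

(** * Rips complexes as clique complexes *)

Section VRBetti.
Variables (R : realType) (k : nat) (P : seq 'rV[R]_k).

Definition idist (e : 'I_(size P) * 'I_(size P)) : R :=
  edist (nth 0 P e.1) (nth 0 P e.2).

Lemma edist_ge0 m (x y : 'rV[R]_m) : 0 <= edist x y.
Proof. exact: sqrtr_ge0. Qed.

Lemma edistxx m (x : 'rV[R]_m) : edist x x = 0.
Proof. by rewrite /edist big1 ?sqrtr0 // => i _; rewrite subrr expr0n. Qed.

Lemma bigmax_le_iff (I : finType) (A : {set I}) (F : I -> R) r :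
  0 <= r -> (\big[Num.max/0]_(i in A) F i <= r) = [forall i in A, F i <= r].
Proof.
move=> r0; apply/bigmax_leP/forall_inP => [[_ h] i|h]; [exact: h|by split].
Qed.

Lemma vr_diam_le (A : {set 'I_(size P)}) r : A != finset.set0 ->
  (vr_diam A <= r) = clique [set e | idist e <= r] A.
Proof.
(* For negative [r] both sides fail: diameters are nonnegative, and [a] has distance 0 to itself. *)
move=> /finset.set0Pn [a aA]; have [r0|r0] := leP 0 r; last first.
  transitivity false; last first.
    apply/esym/negP => /cliqueP /(_ _ _ aA aA); rewrite inE /idist edistxx.
    by rewrite leNgt r0.
  by apply/negbTE; rewrite -ltNge (lt_le_trans r0) // /vr_diam bigmax_ge_id.
rewrite /vr_diam bigmax_le_iff //; apply/forall_inP/cliqueP => [h u v uA vA|h u uA].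
  by have := h u uA; rewrite bigmax_le_iff // inE => /forall_inP; exact.
rewrite bigmax_le_iff //; apply/forall_inP => v vA.
by have := h u v uA vA; rewrite inE.
Qed.

Lemma pbetti1E r s :
  pbetti1 P r s = betti [set e | idist e <= r] [set e | idist e <= s].
Proof.
have selE p t : selmx P p t = selc p [set e | idist e <= t].
  rewrite /selmx /selc; congr diag_mx; apply/rowP => i; rewrite !mxE.
  rewrite /sset /vset; case: eqP => //= c; rewrite vr_diam_le //.
  by rewrite -finset.card_gt0 c.
by rewrite /pbetti1 /cycles1 /bounds1 !selE.
Qed.

End VRBetti.

(** * Diagrams of an abstract submodular rank function *)

Section Persistence.
Variables (E : finType) (b : {set E} -> {set E} -> nat).
Hypothesis b_submod : forall G G' H H' : {set E}, G \subset G' -> H \subset H' ->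
  (b G H + b G' H' <= b G' H + b G H')%N.
Variable R : realDomainType.
Implicit Types (G H : {set E}) (d : E -> R) (D : seq (R * R)) (x y : R).

(* Number of classes born between G0 and G1 that die between H0 and H1. *)
Definition mass G0 G1 H0 H1 : int :=
  (b G1 H0)%:Z - (b G0 H0)%:Z - (b G1 H1)%:Z + (b G0 H1)%:Z.

Lemma mass_ge0 G0 G1 H0 H1 : G0 \subset G1 -> H0 \subset H1 ->
  0 <= mass G0 G1 H0 H1.
Proof. by move=> sG sH; have := b_submod sG sH; rewrite /mass; lia. Qed.

Definition le_set d x : {set E} := [set e | d e <= x].
Definition lt_set d x : {set E} := [set e | d e < x].

(** Multiplicities are prescribed strictly above the diagonal and no other points are allowed, so
    [D] is determined up to order. *)
Definition represents D d :=
  all (fun p => p.1 < p.2) D /\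
  forall x y, x < y ->
    (count_mem (x, y) D)%:Z = mass (lt_set d x) (le_set d x) (lt_set d y) (le_set d y).

Lemma represents_perm D D' d : represents D d -> represents D' d -> perm_eq D D'.
Proof.
move=> [oD cD] [oD' cD']; apply/allP => -[x y] _ /=; apply/eqP.
have [xy|xy] := boolP (x < y).
  by apply/eqP; rewrite -eqz_nat cD // cD'.
have out D0 : all (fun p => p.1 < p.2) D0 -> count_mem (x, y) D0 = 0%N.
  move=> /allP h; apply/eqP; rewrite -leqn0 leqNgt -has_count has_pred1.
  by apply/negP => /h /=; rewrite (negbTE xy).
by rewrite !out.
Qed.

(** The shape of [dgm1_seq] with level numbers for coordinates, so that different values can be
    substituted later. *)
Definition bars m (M : nat -> nat -> nat) : seq (nat * nat) :=
  flatten [seq nseq (M ab.1 ab.2) ab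
          | ab <- [seq ab <- [seq (a, b) | a <- iota 0 m, b <- iota 0 m]
                  | (ab.1 < ab.2)%N]].

Lemma mem_bars m M p : p \in bars m M -> (p.1 < p.2 < m)%N.
Proof.
case/flattenP => s /mapP [q]; rewrite mem_filter => /andP[q12].
case/allpairsP => -[a c] /= [ai ci eq] -> /nseqP[-> _]; move: ai ci q12.
by rewrite eq !mem_iota /=; lia.
Qed.

Section Levels.
Variables (rho : E -> nat) (m : nat) (c : nat -> R).
Hypothesis rho_lt : forall e, (rho e < m)%N.
Hypothesis c_mono : forall i j, (i <= j)%N -> (j < m)%N -> c i <= c j.

(** Filtration by level number. As [c] is only weakly monotone, several levels may share one value,
    and this filtration refines the sublevel filtration of [c \o rho]. *)
Definition below k : {set E} := [set e | (rho e < k)%N].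

Definition level_mass i j := `|mass (below i) (below i.+1) (below j) (below j.+1)|%N.

Let d e := c (rho e).

Lemma below_subS i : below i \subset below i.+1.
Proof. by apply/fintype.subsetP => e; rewrite !inE => /ltnW. Qed.

Lemma level_massE i j :
  (level_mass i j)%:Z = mass (below i) (below i.+1) (below j) (below j.+1).
Proof. by rewrite /level_mass gez0_abs // mass_ge0 // below_subS. Qed.

(** The levels satisfying [Q] form an initial segment, over which the sum telescopes. *)
Lemma sum_initial (Phi : {set E} -> int) (Q : pred nat) :
  (forall i j, (i <= j)%N -> (j < m)%N -> Q j -> Q i) ->
  \sum_(0 <= i < m | Q i) (Phi (below i.+1) - Phi (below i)) =
  Phi [set e | Q (rho e)] - Phi (below 0).
Proof.
move=> Qdown.
have [k km Qk] : exists2 k, (k <= m)%N & forall i, (i < m)%N -> Q i = (i < k)%N.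
  elim: (m) Qdown => [_|m' IH Qd]; first by exists 0%N.
  have [Qm|Qm] := boolP (Q m').
    by exists m'.+1 => // i im; rewrite im; apply: (Qd _ m').
  have [|k km' h] := IH; first by move=> i j ij jm; apply: Qd => //; exact: ltnW.
  exists k; first exact: leqW.
  move=> i; rewrite ltnS leq_eqVlt => /orP[/eqP ->|im]; last exact: h.
  by rewrite (negbTE Qm) ltnNge km'.
have -> : [set e | Q (rho e)] = below k.
  by apply/setP => e; rewrite !inE Qk.
rewrite -(telescope_sumr (fun i => Phi (below i))) //.
rewrite (big_nat_widen _ _ _ _ _ km).
rewrite [LHS]big_nat_cond [RHS]big_nat_cond; apply: eq_bigl => i /=.
by case: (ltnP i m) => //= im; rewrite ?andbF // Qk // im.
Qed.

Lemma sum_level (Phi : {set E} -> int) x :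
  \sum_(0 <= i < m | c i == x) (Phi (below i.+1) - Phi (below i)) =
  Phi (le_set d x) - Phi (lt_set d x).
Proof.
have h1 := @sum_initial Phi (fun i => c i <= x) _.
have h2 := @sum_initial Phi (fun i => c i < x) _.
have -> : Phi (le_set d x) - Phi (lt_set d x) =
   (Phi (le_set d x) - Phi (below 0)) - (Phi (lt_set d x) - Phi (below 0)).
  by rewrite opprB addrA subrK.
rewrite -h1; last by move=> i j ij jm; apply: le_trans; exact: c_mono.
rewrite -h2; last by move=> i j ij jm; apply: le_lt_trans; exact: c_mono.
rewrite [X in X - _]big_mkcond [X in _ - X]big_mkcond [LHS]big_mkcond /=.
rewrite -sumrB; apply: eq_bigr => i _.
by case: ltgtP; rewrite ?subr0 ?subrr.
Qed.

(** [mass] is additive in both intervals, so the level masses over all levels of values [x] and [y]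
    telescope to the mass of the sublevel sets. *)
Lemma count_bars x y : x < y ->
  (count_mem (x, y) [seq (c p.1, c p.2) | p <- bars m level_mass])%:Z =
  mass (lt_set d x) (le_set d x) (lt_set d y) (le_set d y).
Proof.
move=> xy; rewrite count_map count_flatten -map_comp sumnE big_map big_filter.
rewrite big_mkcond big_allpairs_dep /=.
rewrite (big_morph Posz PoszD (erefl _)).
pose Phi (H G : {set E}) : int := (b G H)%:Z.
pose Th H := Phi H (le_set d x) - Phi H (lt_set d x).
transitivity (\sum_(0 <= j < m | c j == y) - (Th (below j.+1) - Th (below j))); last first.
  by rewrite sumrN sum_level /Th /Phi /mass; ring.
have eqT j : - (Th (below j.+1) - Th (below j)) =
  \sum_(0 <= i < m | c i == x) mass (below i) (below i.+1) (below j) (below j.+1).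
  rewrite /Th -!sum_level -sumrB -sumrN; apply: eq_bigr => i _.
  by rewrite /Phi /mass; ring.
under [RHS]eq_bigr do rewrite eqT.
rewrite /index_iota subn0 exchange_big /= [RHS]big_mkcond /=.
apply: eq_big_seq => i; rewrite mem_iota /= => im.
rewrite (big_morph Posz PoszD (erefl _)).
case: ifPn => [/eqP ci|ci]; last first.
  apply: big1_seq => j _; case: ifP => // _.
  by rewrite count_nseq /= xpair_eqE (negbTE ci).
rewrite [RHS]big_mkcond /=; apply: eq_big_seq => j; rewrite mem_iota /= => jm.
rewrite -level_massE; case: (ltnP i j) => ij.
  by rewrite count_nseq /= xpair_eqE ci eqxx; case: eqP => _; rewrite ?mul1n ?mul0n.
(* The pairs with [j <= i], absent from [bars], cannot have values [x < y]. *)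
case: eqP => // cj; have := c_mono ij im; rewrite cj ci => yx.
by rewrite leNgt xy in yx.
Qed.

Lemma represents_bars :
  represents [seq p <- [seq (c p.1, c p.2) | p <- bars m level_mass] | p.1 < p.2] d.
Proof.
split=> [|x y xy]; first exact: filter_all.
rewrite -count_bars // count_filter; congr (Posz _); apply: eq_count => p /=.
by case: eqP => // ->; rewrite /= xy.
Qed.

End Levels.
End Persistence.

(** * Matchings of augmented diagrams *)

Section Matching.
Variable R : realType.
Implicit Types (D : seq (R * R)) (p q : R * R) (x y delta : R).

(** A witness with a uniform bound, in place of a bound on the infimum [bottleneck]: witnesses can
    be composed and inverted. *)
Definition matched D D' delta :=
  exists2 phi : aug D -> aug D', bijective phi &
    forall u, linf (aug_pt u) (aug_pt (phi u)) <= delta.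

Lemma linfxx p : linf p p = 0.
Proof. by rewrite /linf !subrr normr0 maxxx. Qed.

Lemma linfC p q : linf p q = linf q p.
Proof. by rewrite /linf distrC [X in Num.max _ X]distrC. Qed.

Lemma linf_le p q delta :
  (linf p q <= delta) = (`|p.1 - q.1| <= delta) && (`|p.2 - q.2| <= delta).
Proof. exact: ge_max. Qed.

Lemma linf_triangle p q r x y : linf p q <= x -> linf q r <= y -> linf p r <= x + y.
Proof.
rewrite !linf_le => /andP[h1 h2] /andP[h3 h4].
apply/andP; split; first exact: le_trans (ler_distD q.1 _ _) (lerD h1 h3).
exact: le_trans (ler_distD q.2 _ _) (lerD h2 h4).
Qed.

Lemma matched_sym D D' delta : matched D D' delta -> matched D' D delta.
Proof.
move=> [phi [psi phiK psiK] h]; exists psi; first by exists phi.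
by move=> u; rewrite linfC -{2}[u]psiK.
Qed.

Lemma matched_trans D1 D2 D3 x y :
  matched D1 D2 x -> matched D2 D3 y -> matched D1 D3 (x + y).
Proof.
move=> [phi bphi h] [psi bpsi h']; exists (psi \o phi); first exact: bij_comp.
by move=> u; apply: linf_triangle (h u) (h' _).
Qed.

Lemma matched_map (A : eqType) (L : seq A) (p q : A -> R * R) delta :
  0 <= delta -> {in L, forall a, linf (p a) (q a) <= delta} ->
  matched (map p L) (map q L) delta.
Proof.
move=> d0 h.
have e1 : size (map p L) = size (map q L) by rewrite !size_map.
pose cast D D' (e : size D = size D') (u : aug D) : aug D' :=
  match u with inl i => inl (cast_ord e i) | inr a => inr a end.
exists (@cast _ _ e1).
  exists (@cast _ _ (esym e1)); case=> //= i; congr inl; exact: val_inj.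
case=> [i|[a k]] /=; last by rewrite linfxx.
have iL : (i < size L)%N by rewrite -(size_map p).
case: L h i iL {e1} => [|a0 L] h i iL //.
by rewrite !(nth_map a0) //; apply/h/mem_nth.
Qed.

Lemma matched_perm D D' : perm_eq D D' -> matched D D' 0.
Proof.
move=> pDD'; have /(perm_iotaP (0, 0)) [s ps eD] := pDD'.
have sD : size s = size D' by rewrite (perm_size ps) size_iota.
pose t i := nth 0%N s i.
have t_lt i : (i < size D)%N -> (t i < size D')%N.
  rewrite (perm_size pDD') -{1}sD => /(mem_nth 0%N).
  by rewrite (perm_mem ps) mem_iota.
pose f (i : 'I_(size D)) : 'I_(size D') := Ordinal (t_lt i (ltn_ord i)).
have f_inj : injective f.
  move=> i j /(congr1 val) /= /eqP; rewrite /t nth_uniq.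
  - by move=> /eqP; exact: val_inj.
  - by rewrite sD -(perm_size pDD').
  - by rewrite sD -(perm_size pDD').
  - by rewrite (perm_uniq ps) iota_uniq.
have [f' fK f'K] : bijective f.
  by apply: inj_card_bij f_inj _; rewrite !card_ord (perm_size pDD').
pose sumf A B C (g : A -> B) (u : A + C) : B + C :=
  match u with inl i => inl (g i) | inr a => inr a end.
exists (sumf _ _ _ f).
  by exists (sumf _ _ _ f'); case=> //= i; rewrite ?fK ?f'K.
case=> [i|[a k]] /=; last by rewrite linfxx.
rewrite {1}eD (nth_map 0%N) ?linfxx // sD -(perm_size pDD') //.
Qed.

(* The extra diagonal point (x, x) is absorbed into the infinitely many copies
   already present, shifting them by one. *)
Lemma matched_cons_diag D x : matched ((x, x) :: D) D 0.
Proof.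
pose phi (u : aug ((x, x) :: D)) : aug D :=
  match u with
  | inl i => if unlift ord0 i is Some j then inl j else inr (x, 0%N)
  | inr (a, k) => inr (a, if a == x then k.+1 else k)
  end.
pose psi (u : aug D) : aug ((x, x) :: D) :=
  match u with
  | inl i => inl (lift ord0 i)
  | inr (a, k) => if (a == x) then (if k is k'.+1 then inr (a, k') else inl ord0)
                  else inr (a, k)
  end.
exists phi.
  exists psi; case=> [i|[a k]] /=.
  - by case: unliftP => [j ->|->] //=; rewrite eqxx.
  - by case: (eqVneq a x) => [->|] /=.
  - by rewrite liftK.
  - case: (eqVneq a x) => [->|ax] /=; last by rewrite (negbTE ax).
    by case: k => [|k] /=; rewrite ?unlift_none ?eqxx.
case=> [i|[a k]] /=; last by rewrite linfxx.
by case: unliftP => [j ->|->] /=; rewrite linfxx.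
Qed.

Lemma matched_cat_diag D1 D : all (fun p => p.1 == p.2) D1 -> matched (D1 ++ D) D 0.
Proof.
elim: D1 => [_|[x y] D1 IH /= /andP[/eqP -> /IH h]].
  exact: matched_perm (perm_refl _).
by rewrite -[0]addr0; apply: matched_trans h; exact: matched_cons_diag.
Qed.

Lemma matched_filter D : all (fun p => p.1 <= p.2) D ->
  matched D [seq p <- D | p.1 < p.2] 0.
Proof.
move=> /allP hD; rewrite -[0]addr0.
apply: (@matched_trans _ ([seq p <- D | ~~ (p.1 < p.2)] ++ [seq p <- D | p.1 < p.2])).
  by apply: matched_perm; rewrite perm_sym perm_catC perm_filterC.
apply: matched_cat_diag; apply/allP => p; rewrite mem_filter -leNgt => /andP[h pD].
by rewrite eq_le h hD.
Qed.

Lemma matched_ge0 D D' delta : matched D D' delta -> 0 <= delta.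
Proof.
move=> [phi _ h]; apply: le_trans (h (inr (0, 0%N))).
by rewrite /linf le_max normr_ge0.
Qed.

Lemma matched_bottleneck D D' delta :
  matched D D' delta -> (bottleneck D D' <= delta%:E)%E.
Proof.
move=> [phi bphi h]; rewrite /bottleneck.
apply: (@le_trans _ _ (ereal_sup [set (linf (aug_pt x) (aug_pt (phi x)))%:E
                            | x in [set: aug D]])%classic).
  by apply: ereal_inf_lbound; exists phi.
by apply: ub_ereal_sup => _ [u _ <-]; rewrite lee_fin.
Qed.

Lemma maxpers_ge0 D : 0 <= maxpers D.
Proof. exact: bigmax_ge_id. Qed.

Lemma maxpers_ge D p : p \in D -> p.2 - p.1 <= maxpers D.
Proof.
move=> pD.
exact: (@le_bigmax_seq _ _ _ D 0 p predT (fun q => q.2 - q.1) pD isT).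
Qed.

(** Birth and death each move by at most [delta]. A point matched to the diagonal has persistence at
    most [2 * delta], which suffices since [maxpers] is nonnegative. *)
Lemma matched_maxpers_le D D' delta :
  matched D D' delta -> maxpers D <= maxpers D' + 2 * delta.
Proof.
move=> m; have d0 := matched_ge0 m; case: m => phi _ h.
have m0 := maxpers_ge0 D'.
rewrite {1}/maxpers big_seq; apply: bigmax_le; first by lra.
move=> p /(nthP (0, 0)) [i iD <-].
have := h (inl (Ordinal iD)); rewrite linf_le /=.
case: (phi _) => [j|[a k]] /=; rewrite !ler_norml => /andP[/andP[h1 h2] /andP[h3 h4]].
  by have := maxpers_ge (mem_nth (0, 0) (ltn_ord j)); lra.
by lra.
Qed.

Lemma matched_maxpers D D' delta :
  matched D D' delta -> `|maxpers D - maxpers D'| <= 2 * delta.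
Proof.
move=> m; have := matched_maxpers_le m.
by have := matched_maxpers_le (matched_sym m); rewrite ler_norml; lra.
Qed.

End Matching.

(** * Bottleneck stability *)

Section Stability.
Variables (E : finType) (b : {set E} -> {set E} -> nat).
Hypothesis b_submod : forall G G' H H' : {set E}, G \subset G' -> H \subset H' ->
  (b G H + b G' H' <= b G' H + b G H')%N.
Variable R : realType.
Implicit Types (d : E -> R) (D : seq (R * R)) (delta : R).

(** Sorting by [d0 + d1] makes both functions weakly monotone along one list, since no pair is
    ordered oppositely. Both diagrams then come from the same [bars]. *)
Lemma unreversed_matched d0 d1 delta :
  (forall e e', d0 e < d0 e' -> d1 e <= d1 e') -> 0 <= delta ->
  (forall e, `|d0 e - d1 e| <= delta) ->
  exists D0 D1, [/\ represents b D0 d0, represents b D1 d1 & matched D0 D1 delta].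
Proof.
move=> nrev delta0 hd.
pose le e e' := d0 e + d1 e <= d0 e' + d1 e'.
pose es := sort le (enum E).
have es_all e : e \in es by rewrite mem_sort mem_enum.
have es_sorted : sorted le es by apply: sort_sorted => e e'; exact: le_total.
pose rho e := index e es.
pose c0 i := nth 0 (map d0 es) i.
pose c1 i := nth 0 (map d1 es) i.
have rho_lt e : (rho e < size es)%N by rewrite index_mem.
have E0 : d0 =1 c0 \o rho by move=> e; rewrite /c0 /= (nth_map e) // nth_index.
have E1 : d1 =1 c1 \o rho by move=> e; rewrite /c1 /= (nth_map e) // nth_index.
have es_mono i j : (i <= j)%N -> (j < size es)%N -> c0 i <= c0 j /\ c1 i <= c1 j.
  move=> ij jm; have im := leq_ltn_trans ij jm.
  have e0 := tnth (in_tuple es) (Ordinal jm).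
  rewrite /c0 /c1 !(nth_map e0) //.
  have := @sorted_leq_nth _ le _ _ e0 es es_sorted i j im jm ij; rewrite /le.
  move=> /(_ (fun y x z => @le_trans _ _ _ _ _) (fun x => lexx _)) hs.
  set e := nth e0 es i in hs *; set e' := nth e0 es j in hs *.
  have [h|] := ltP (d0 e) (d0 e'); last rewrite le_eqVlt => /orP[/eqP h|h].
  - by split; [exact: ltW|exact: nrev].
  - by split; lra.
  - by have := nrev _ _ h; split; lra.
have mono0 i j : (i <= j)%N -> (j < size es)%N -> c0 i <= c0 j by move=> ij /(es_mono _ _ ij) [].
have mono1 i j : (i <= j)%N -> (j < size es)%N -> c1 i <= c1 j by move=> ij /(es_mono _ _ ij) [].
have ext D d d' : d =1 d' -> represents b D d' -> represents b D d.
  by move=> /funext ->.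
pose L := bars (size es) (level_mass b rho).
exists [seq p <- [seq (c0 p.1, c0 p.2) | p <- L] | p.1 < p.2].
exists [seq p <- [seq (c1 p.1, c1 p.2) | p <- L] | p.1 < p.2].
split.
- exact: ext E0 (represents_bars b_submod rho_lt mono0).
- exact: ext E1 (represents_bars b_submod rho_lt mono1).
have le_pts c : (forall i j, (i <= j)%N -> (j < size es)%N -> c i <= c j) ->
    all (fun p : R * R => p.1 <= p.2) [seq (c p.1, c p.2) | p <- L].
  move=> cm; apply/allP => _ /mapP [p /mem_bars /andP[p12 p2] ->] /=.
  by apply: cm => //; exact: ltnW.
(* Bars collapsed to the diagonal by either function are restored at cost 0 before matching bar by
   bar. *)
rewrite -[delta]addr0; apply: matched_trans (matched_filter (le_pts _ mono1)).
rewrite -[delta]add0r; apply: matched_trans (matched_sym (matched_filter (le_pts _ mono0))) _.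
apply: matched_map => // p /mem_bars /andP[p12 p2].
have close i : (i < size es)%N -> `|c0 i - c1 i| <= delta.
  move=> im; have e0 := tnth (in_tuple es) (Ordinal im).
  by rewrite /c0 /c1 !(nth_map e0).
by rewrite linf_le /= !close // (ltn_trans p12).
Qed.

Lemma represents_exists d : exists D, represents b D d.
Proof.
have [|||D [_ [h _ _]]] := @unreversed_matched d d 0; last by exists D.
- by move=> e e' /ltW.
- by [].
- by move=> e; rewrite subrr normr0.
Qed.

Definition reversals d0 d1 : {set E * E} :=
  [set p | (d0 p.1 < d0 p.2) && (d1 p.2 < d1 p.1)].

(* Interpolating linearly between d0 and d1 and stopping where two values cross
   splits the problem into two with fewer reversals each. *)
Lemma bottleneck_stability d0 d1 delta D0 D1 :
  0 <= delta -> (forall e, `|d0 e - d1 e| <= delta) ->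
  represents b D0 d0 -> represents b D1 d1 -> matched D0 D1 delta.
Proof.
have [k] := ubnP #|reversals d0 d1|.
elim: k d0 d1 delta D0 D1 => // k IH d0 d1 delta D0 D1 rk delta0 hd r0 r1.
have [rev0|] := eqVneq (reversals d0 d1) finset.set0.
  have [|D0' [D1' [r0' r1' m]]] := @unreversed_matched d0 d1 delta _ delta0 hd.
    move=> e e' h; rewrite leNgt; apply/negP => h'.
    by have := finset.in_set0 (e, e'); rewrite -rev0 inE h h'.
  rewrite -[delta]addr0; apply: matched_trans (matched_perm (represents_perm r1' r1)).
  rewrite -[delta]add0r; apply: matched_trans m.
  exact: matched_perm (represents_perm r0 r0').
case/finset.set0Pn => -[e e']; rewrite inE /= => /andP[h0 h1].
(* The time at which the interpolated values of [e] and [e'] meet. *)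
pose l := (d0 e' - d0 e) / ((d0 e' - d0 e) + (d1 e - d1 e')).
have pos : 0 < (d0 e' - d0 e) + (d1 e - d1 e') by lra.
have l0 : 0 < l by rewrite divr_gt0 // subr_gt0.
have l1 : l < 1 by rewrite ltr_pdivrMr //; lra.
pose dl x := (1 - l) * d0 x + l * d1 x.
have dle : dl e = dl e'.
  by rewrite /dl /l; field; rewrite gt_eqF.
have [Dl rl] := represents_exists dl.
(* A convex combination keeps any order shared by both ends, so no reversal is created, while the
   tie at [l] removes [(e, e')]. *)
have lt0 : (#|reversals d0 dl| < k)%N.
  apply: (@leq_trans #|reversals d0 d1|) => //.
  apply: proper_card; apply/properP; split; last first.
    by exists (e, e'); rewrite !inE /= ?h0 ?h1 // dle ltxx andbF.
  apply/fintype.subsetP => -[x y]; rewrite !inE /= => /andP[h hl].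
  by rewrite h /= ltNge; apply/negP => hxy; move: hl; rewrite /dl; nra.
have lt1 : (#|reversals dl d1| < k)%N.
  apply: (@leq_trans #|reversals d0 d1|) => //.
  apply: proper_card; apply/properP; split; last first.
    by exists (e, e'); rewrite !inE /= ?h0 ?h1 // dle ltxx.
  apply/fintype.subsetP => -[x y]; rewrite !inE /= => /andP[hl hxy].
  by rewrite hxy andbT ltNge; apply/negP => h; move: hl; rewrite /dl; nra.
have -> : delta = l * delta + (1 - l) * delta by ring.
apply: matched_trans (_ : matched D0 Dl _) (_ : matched Dl D1 _).
  apply: IH r0 rl => //; first by rewrite mulr_ge0 // ltW.
  move=> x; have -> : d0 x - dl x = l * (d0 x - d1 x) by rewrite /dl; ring.
  by rewrite normrM gtr0_norm // ler_wpM2l // ltW.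
apply: IH rl r1 => //; first by rewrite mulr_ge0 // subr_ge0 ltW.
move=> x; have -> : dl x - d1 x = (1 - l) * (d0 x - d1 x) by rewrite /dl; ring.
by rewrite normrM gtr0_norm ?subr_gt0 // ler_wpM2l // subr_ge0 ltW.
Qed.

End Stability.

(** * The Rips diagram and its independence of repeated points *)

Section Diagrams.
Variables (R : realType) (k : nat).
Implicit Types (P Q : seq 'rV[R]_k).

Lemma critvals_lt P : sorted <%R (critvals P).
Proof. by rewrite /critvals sort_lt_sorted undup_uniq. Qed.

Lemma idist_critvals P (e : 'I_(size P) * 'I_(size P)) : idist e \in critvals P.
Proof.
rewrite mem_sort mem_undup; apply/allpairsP.
by exists (nth 0 P e.1, nth 0 P e.2); split; rewrite //= mem_nth.
Qed.

Lemma dgm1_seq_represents P :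
  represents (@betti (size P)) (dgm1_seq P) (@idist R k P).
Proof.
pose cv := critvals P.
pose rho (e : 'I_(size P) * 'I_(size P)) := index (idist e) cv.
pose c i := nth 0 cv i.
have rho_lt e : (rho e < size cv)%N by rewrite index_mem idist_critvals.
have cE : @idist R k P = c \o rho.
  by apply/funext => e; rewrite /c /= nth_index // idist_critvals.
have c_lt i j : (i < j)%N -> (j < size cv)%N -> c i < c j.
  move=> ij jm; rewrite /c lt_sorted_ltn_nth ?critvals_lt //.
  exact: ltn_trans ij jm.
have c_mono i j : (i <= j)%N -> (j < size cv)%N -> c i <= c j.
  by rewrite leq_eqVlt => /orP[/eqP -> //|ij jm]; exact/ltW/c_lt.
have belowE i : (i < size cv)%N -> [set e | idist e <= cv`_i] = below rho i.+1.
  move=> im; apply/setP => e; rewrite !inE cE /= ltnS; apply/idP/idP => h.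
    by rewrite leqNgt; apply/negP => /c_lt /(_ (rho_lt e)); rewrite ltNge h.
  exact: c_mono.
have pbE i j : (i < size cv)%N -> (j < size cv)%N ->
    pb_idx P i j = (betti (below rho i.+1) (below rho j.+1))%:Z.
  by move=> im jm; rewrite /pb_idx pbetti1E -/cv !belowE.
(* Critical index [i] corresponds to [below rho i.+1], so the indices [i] and [j.-1] of [mult1]
   become levels [i.+1] and [j]. For [i = 0] the missing terms belong to the empty graph. *)
have multE i j : (i < j)%N -> (j < size cv)%N ->
    `|mult1 P i j|%N = level_mass (@betti (size P)) rho i j.
  case: j => // j; rewrite ltnS => ij jm.
  have jm' : (j < size cv)%N by exact: ltnW.
  have im := leq_ltn_trans ij jm'.
  rewrite /level_mass /mass /mult1 /= !pbE //; congr absz.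
  case: i ij im => [|i] ij im; last by rewrite !pbE // ltnW.
  suff -> : below rho 0 = finset.set0 by rewrite !betti0.
  by apply/setP => e; rewrite !inE.
have -> : dgm1_seq P =
    [seq (c p.1, c p.2) | p <- bars (size cv) (level_mass (@betti (size P)) rho)].
  rewrite /dgm1_seq /bars map_flatten -map_comp -/cv; congr flatten.
  apply/eq_in_map => -[i j]; rewrite mem_filter /= => /andP[ij].
  case/allpairsP => -[i' j'] /= [_]; rewrite mem_iota /= add0n => jm [ei ej].
  by rewrite map_nseq /= multE // ej.
(* Critical values increase strictly, so no bar is degenerate and the filter removes nothing. *)
rewrite cE -[X in represents _ X]filter_predT.
have := represents_bars (@betti_submod (size P)) rho_lt c_mono.
congr (represents _ _ _); apply: eq_in_filter => _ /mapP[p /mem_bars /andP[p12 p2] ->].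
by rewrite /= c_lt.
Qed.

(** Choosing indices of equal points gives maps in both directions that preserve all distances, so
    contiguity applies. *)
Lemma betti_family_le n n' (x : 'I_n -> 'rV[R]_k) (x' : 'I_n' -> 'rV[R]_k) (r s : pred R) :
  (forall u, exists v, x' v = x u) -> (forall v, exists u, x u = x' v) ->
  {subset r <= s} ->
  (betti [set e : 'I_n * 'I_n | r (edist (x e.1) (x e.2))]
         [set e : 'I_n * 'I_n | s (edist (x e.1) (x e.2))] <=
   betti [set e : 'I_n' * 'I_n' | r (edist (x' e.1) (x' e.2))]
         [set e : 'I_n' * 'I_n' | s (edist (x' e.1) (x' e.2))])%N.
Proof.
move=> /choice [f fE] /choice [g gE] rs.
apply: (@betti_contiguous _ _ f g).
- by apply/fintype.subsetP => e; rewrite !inE; apply: rs.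
- by move=> u v; rewrite !inE /= !fE.
- by move=> u v; rewrite !inE /= !gE.
- by move=> u v; rewrite !inE /= gE fE.
- by move=> u v; rewrite !inE /= gE fE.
Qed.

(** [dgm1] removes duplicates, and two clouds may have different numbers of distinct points;
    indexing by a family with repetitions puts both on one index set. *)
Lemma dgm1_represents n (x : 'I_n -> 'rV[R]_k) P :
  (forall u, x u \in P) -> (forall p, p \in P -> exists u, x u = p) ->
  represents (@betti n) (dgm1 P) (fun e => edist (x e.1) (x e.2)).
Proof.
move=> xP Px; have [hlt hcount] := dgm1_seq_represents (undup P).
split=> // a c ac; rewrite hcount //.
pose x' (v : 'I_(size (undup P))) := nth 0 (undup P) v.
have h1 u : exists v, x' v = x u.
  have iu : (index (x u) (undup P) < size (undup P))%N by rewrite index_mem mem_undup.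
  by exists (Ordinal iu); rewrite /x' /= nth_index // mem_undup.
have h2 v : exists u, x u = x' v by apply: Px; rewrite -mem_undup mem_nth.
have eqb (r s : pred R) : {subset r <= s} ->
    betti [set e : 'I_n * 'I_n | r (edist (x e.1) (x e.2))]
          [set e : 'I_n * 'I_n | s (edist (x e.1) (x e.2))] =
    betti [set e : 'I_(size (undup P)) * 'I_(size (undup P)) | r (idist e)]
          [set e : 'I_(size (undup P)) * 'I_(size (undup P)) | s (idist e)].
  move=> rs; apply/eqP; rewrite eqn_leq.
  by rewrite (betti_family_le h1 h2 rs) (betti_family_le h2 h1 rs).
rewrite /mass /le_set /lt_set.
rewrite -(eqb (<= a) (< c)); last by move=> z /le_lt_trans; apply.
rewrite -(eqb (< a) (< c)); last by move=> z /lt_trans; apply.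
rewrite -(eqb (<= a) (<= c)); last by move=> z /le_trans; apply; exact: ltW.
rewrite -(eqb (< a) (<= c)) // => z /lt_trans h.
by apply: ltW; exact: h.
Qed.

End Diagrams.

(** * Euclidean estimates and the sliding window embedding *)

Section Euclid.
Variable R : realType.

(** The sum of squares of [A * b i - C * a i] equals [A * (A * B - C ^+ 2)]; if [A = 0], every [a i]
    vanishes. *)
Lemma cauchy_schwarz_sum (I : finType) (a b : I -> R) :
  (\sum_i a i * b i) ^+ 2 <= (\sum_i a i ^+ 2) * (\sum_i b i ^+ 2).
Proof.
set C := \sum_i a i * b i; set A := \sum_i a i ^+ 2; set B := \sum_i b i ^+ 2.
have A0 : 0 <= A by apply: sumr_ge0 => i _; exact: sqr_ge0.
have : 0 <= \sum_i (A * b i - C * a i) ^+ 2 by apply: sumr_ge0 => i _; exact: sqr_ge0.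
have -> : \sum_i (A * b i - C * a i) ^+ 2 = A * (A * B - C ^+ 2).
  transitivity (\sum_i (A ^+ 2 * b i ^+ 2 - 2 * A * C * (a i * b i) + C ^+ 2 * a i ^+ 2)).
    by apply: eq_bigr => i _; ring.
  by rewrite big_split sumrB -!mulr_sumr -/A -/B -/C /=; ring.
move: A0; rewrite le_eqVlt => /orP[/eqP A0|A0]; last by rewrite pmulr_rge0 // subr_ge0.
move=> _; suff -> : C = 0 by rewrite -A0 mul0r expr0n.
apply: big1 => i _; have /eqP := esym A0; rewrite psumr_eq0; last by move=> *; exact: sqr_ge0.
by move=> /allP /(_ i (mem_index_enum i)); rewrite sqrf_eq0 => /eqP ->; rewrite mul0r.
Qed.

Lemma edist_sym n (x y : 'rV[R]_n) : edist x y = edist y x.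
Proof. by rewrite /edist; congr Num.sqrt; apply: eq_bigr => i _; ring. Qed.

Lemma edist_triangle n (x y z : 'rV[R]_n) : edist x z <= edist x y + edist y z.
Proof.
rewrite /edist.
pose a (i : 'I_n) := x ord0 i - y ord0 i; pose b (i : 'I_n) := y ord0 i - z ord0 i.
have -> : \sum_(i < n) (x ord0 i - z ord0 i) ^+ 2 =
  \sum_i a i ^+ 2 + \sum_i b i ^+ 2 + 2 * \sum_i a i * b i.
  by rewrite mulr_sumr -!big_split; apply: eq_bigr => i _; rewrite /a /b /=; ring.
rewrite -/(a _) -/(b _).
have := cauchy_schwarz_sum a b.
set C := \sum_i a i * b i; set A := \sum_i a i ^+ 2; set B := \sum_i b i ^+ 2.
have A0 : 0 <= A by apply: sumr_ge0 => i _; exact: sqr_ge0.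
have B0 : 0 <= B by apply: sumr_ge0 => i _; exact: sqr_ge0.
move=> cs; rewrite -[leRHS]ger0_norm ?addr_ge0 ?sqrtr_ge0 //.
rewrite -sqrtr_sqr ler_wsqrtr // sqrrD !sqr_sqrtr //.
have : C <= Num.sqrt A * Num.sqrt B.
  by rewrite -sqrtrM // (le_trans (ler_norm C)) // -sqrtr_sqr ler_wsqrtr.
lra.
Qed.

Lemma edist_perturb n (x y x' y' : 'rV[R]_n) e :
  edist x x' <= e -> edist y y' <= e -> `|edist x y - edist x' y'| <= 2 * e.
Proof.
move=> hx hy; have t1 := edist_triangle x x' y; have t2 := edist_triangle x' y' y.
have t3 := edist_triangle x' x y'; have t4 := edist_triangle x y y'.
have := edist_sym x x'; have := edist_sym y y' => sy sx.
by rewrite ler_norml; lra.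
Qed.

(** Both clouds are indexed by positions in [T]. Moving both endpoints changes a distance by at most
    [2 * e], and stability applies to these weights. *)
Lemma dgm1_matched k (A : eqType) (T : seq A) (x y : A -> 'rV[R]_k) e : 0 <= e ->
  (forall t, t \in T -> edist (x t) (y t) <= e) ->
  matched (dgm1 (map x T)) (dgm1 (map y T)) (2 * e).
Proof.
move=> e0 hxy; pose pt (i : 'I_(size T)) := tnth (in_tuple T) i.
have ptT i : pt i \in T by exact: mem_tnth.
have rep (z : A -> 'rV[R]_k) :
    represents (@betti (size T)) (dgm1 (map z T)) (fun e => edist (z (pt e.1)) (z (pt e.2))).
  apply: (dgm1_represents (x := z \o pt)) => [u|p /mapP[t /(nthP t)[i iT <-] ->]].
    by apply: (map_f z); exact: ptT.
  by exists (Ordinal iT); rewrite /= /pt (tnth_nth t).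
apply: (bottleneck_stability (@betti_submod (size T))) (rep x) (rep y).
  by rewrite mulr_ge0.
by move=> -[u v] /=; apply: edist_perturb; exact: hxy.
Qed.

Lemma hausdorff_le n (A : eqType) (T : seq A) (x y : A -> 'rV[R]_n) e : 0 <= e ->
  (forall t, t \in T -> edist (x t) (y t) <= e) ->
  (hausdorff [set x t | t in [set t | t \in T]] [set y t | t in [set t | t \in T]]
     <= e%:E)%E%classic.
Proof.
(* Thickenings use open balls, so the radius is enlarged by an arbitrary [d > 0]. *)
move=> e0 hxy; apply/lee_addgt0Pr => d d0; apply: ereal_inf_lbound.
exists (e + d) => //=; split; first by rewrite ltr_wpDl.
have lt t : t \in T -> edist (x t) (y t) < e + d.
  by move=> /hxy /le_lt_trans; apply; rewrite ltrDl.
split=> _ [t tT <-]; first by exists (y t); [exists t|exact: lt].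
by exists (x t); [exists t|rewrite edist_sym; exact: lt].
Qed.

Lemma seq_argmax (A : eqType) (T : seq A) (F : A -> R) : T != [::] ->
  exists2 t, t \in T & forall s, s \in T -> F s <= F t.
Proof.
elim: T => // a [|a' T] IH _.
  by exists a; rewrite ?mem_head // => s; rewrite inE => /eqP ->.
have [//|t tT ht] := IH.
have [h|h] := leP (F a) (F t).
  exists t; first by rewrite inE tT orbT.
  by move=> s; rewrite inE => /orP[/eqP -> //|/ht].
exists a; first exact: mem_head.
by move=> s; rewrite inE => /orP[/eqP -> //|/ht hs]; exact: le_trans hs (ltW h).
Qed.

Lemma derivable_MVT (f : R -> R) (a b : R) : (forall x, derivable f x 1) -> a < b ->
  exists2 c, a < c < b & f b - f a = derive1 f c * (b - a).
Proof.
move=> fd ab; have [||c] := @MVT _ f (derive1 f) a b ab.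
- by move=> x _; rewrite derive1E; exact: derivableP.
- by apply: derivable_within_continuous => x _; exact: fd.
by rewrite in_itv /= => cab ->; exists c.
Qed.

Lemma edist_swe_le M (f : R -> R) (t tau1 tau2 : R) (c : nat -> R) :
  tau2 <= tau1 ->
  (forall k, (1 <= k <= M)%N -> f (t + k%:R * tau1) - f (t + k%:R * tau2) =
     derive1 f (c k) * (k%:R * (tau1 - tau2))) ->
  edist (swe M f tau1 t) (swe M f tau2 t) <=
  M%:R * (tau1 - tau2) * Num.sqrt (\sum_(1 <= k < M.+1) (derive1 f (c k)) ^+ 2).
Proof.
move=> tau21 hc; set S2 := \sum_(1 <= k < _) _.
have D0 : 0 <= M%:R * (tau1 - tau2) by rewrite mulr_ge0 // subr_ge0.
rewrite -[X in X * _](ger0_norm D0) -sqrtr_sqr -sqrtrM ?sqr_ge0 // ler_wsqrtr //.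
pose F i := (f (t + i%:R * tau1) - f (t + i%:R * tau2)) ^+ 2.
have -> : \sum_(i < M.+1) (swe M f tau1 t ord0 i - swe M f tau2 t ord0 i) ^+ 2 =
    \sum_(0 <= i < M.+1) F i.
  by rewrite big_mkord; apply: eq_bigr => i _; rewrite !mxE.
(* The coordinates of lag 0 agree; each other lag [k] has a factor at most [M]. *)
rewrite big_ltn // {1}/F !mul0r subrr expr0n add0r /S2 mulr_sumr.
rewrite big_nat [leRHS]big_nat; apply: ler_sum => i; rewrite ltnS => iM.
rewrite /F hc // !exprMn mulrC ler_wpM2r ?sqr_ge0 // ler_wpM2r ?sqr_ge0 //.
by rewrite lerXn2r ?nnegrE // ler_nat; case/andP: iM.
Qed.
End Euclid.

(** * The bounds for conditional sliding windows embeddings *)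

Unset Implicit Arguments.
Set Strict Implicit.
Set Printing Implicit Defensive.
Local Open Scope classical_set_scope.

Theorem mainTheorem2 (R : realType) (M w1 w21 w22 : nat) (f1 : R -> R)
  (T : seq R)
  (hw1 : (0 < w1)%N) (hw21 : (0 < w21)%N) (hw22 : (0 < w22)%N)
  (hlt : 2 * (pi : R) / w22%:R < 2 * (pi : R) / w21%:R)
  (hle : 2 * (pi : R) / w21%:R <= 2 * (pi : R) / w1%:R)
  (hdiff : forall x : R, derivable f1 x 1)
  (hper : forall x : R, f1 (x + 2 * (pi : R) / w1%:R) = f1 x)
  (hT0 : T != [::])
  (hT : forall t, t \in T -> 0 <= t <= 2 * (pi : R) / w1%:R) :
  let tau1 := 2 * (pi : R) / (w21%:R * M.+1%:R) in
  let tau2 := 2 * (pi : R) / (w22%:R * M.+1%:R) in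
  let X1 := [set swe M f1 tau1 t | t in [set t | t \in T]] in
  let X2 := [set swe M f1 tau2 t | t in [set t | t \in T]] in
  let D1 := dgm1 [seq swe M f1 tau1 t | t <- T] in
  let D2 := dgm1 [seq swe M f1 tau2 t | t <- T] in
  let score1 := maxpers D1 / Num.sqrt 3 in
  let score2 := maxpers D2 / Num.sqrt 3 in
  let Delta := `|2 * (pi : R) / w21%:R - 2 * (pi : R) / w22%:R| in
  exists t : R, exists c : nat -> R,
    [/\ t \in T,
        (forall k : nat, (1 <= k <= M)%N ->
           t + k%:R * tau2 < c k < t + k%:R * tau1) &
        let S := Num.sqrt (\sum_(1 <= k < M.+1) (derive1 f1 (c k)) ^+ 2) in
        [/\ (hausdorff X1 X2 <= (Num.sqrt M.+1%:R * Delta * S)%:E)%E,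
            (bottleneck D1 D2 <= (2 * Num.sqrt M.+1%:R * Delta * S)%:E)%E,
            `|maxpers D1 - maxpers D2| <= 4 * Num.sqrt M.+1%:R * Delta * S &
            `|score1 - score2| <= 4 * Num.sqrt (M.+1%:R / 3) * Delta * S]].
Proof.
move=> tau1 tau2 X1 X2 D1 D2 score1 score2 Delta.
pose a1 : R := 2 * pi / w21%:R; pose a2 : R := 2 * pi / w22%:R.
have M0 : 0 < M.+1%:R :> R by rewrite ltr0n.
have E1 : tau1 = a1 / M.+1%:R by rewrite /tau1 invfM mulrA.
have E2 : tau2 = a2 / M.+1%:R by rewrite /tau2 invfM mulrA.
have tau_lt : tau2 < tau1 by rewrite E1 E2 ltr_pM2r ?invr_gt0.
have DeltaE : Delta = M.+1%:R * (tau1 - tau2).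
  rewrite /Delta -/a1 -/a2 gtr0_norm ?subr_gt0 // E1 E2 -mulrBl mulrCA.
  by rewrite mulfV ?gt_eqF // mulr1.
(* The mean value points depend on [t]; choosing the worst [t] lets one choice serve all of [T]. *)
have [t tT tmax] := seq_argmax (fun t => Defs.edist (swe M f1 tau1 t) (swe M f1 tau2 t)) hT0.
have /choice [c hc] : forall k : nat, exists x : R, (1 <= k <= M)%N ->
    t + k%:R * tau2 < x < t + k%:R * tau1 /\
    f1 (t + k%:R * tau1) - f1 (t + k%:R * tau2) =
      derive1 f1 x * (k%:R * (tau1 - tau2)).
  move=> k.
  (* Outside the range nothing is required of the point, and 0 is a default. *)
  have [/andP[k1 _]|_] := boolP (1 <= k <= M)%N; last by exists 0.
  have [|x hx e] := derivable_MVT (a := t + k%:R * tau2) (b := t + k%:R * tau1) hdiff.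
    by rewrite ltrD2l ltr_pM2l // ltr0n.
  by exists x => _; split=> //; rewrite e; congr (_ * _); ring.
exists t, c; split=> // [k /hc[] //|S].
have S0 : 0 <= S by exact: sqrtr_ge0.
have Delta0 : 0 <= Delta by exact: normr_ge0.
have sq1 : 1 <= Num.sqrt M.+1%:R :> R by rewrite -{1}sqrtr1 ler_wsqrtr // ler1n.
set e := Num.sqrt M.+1%:R * Delta * S.
have e0 : 0 <= e by rewrite !mulr_ge0 // sqrtr_ge0.
have close s : s \in T -> Defs.edist (swe M f1 tau1 s) (swe M f1 tau2 s) <= e.
  move=> sT; apply: le_trans (tmax s sT) _.
  apply: le_trans (edist_swe_le (ltW tau_lt) (fun k h => (hc k h).2)) _.
  rewrite -/S ler_wpM2r //.
  (* [M * (tau1 - tau2)] is at most [Delta], which is [M.+1] times the same difference, and the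
     square root is at least 1. *)
  apply: (@le_trans _ _ Delta); last by rewrite ler_peMl.
  by rewrite DeltaE ler_wpM2r ?subr_ge0 ?(ltW tau_lt) // ler_nat.
have m := dgm1_matched e0 close.
(* The factor 4 combines the [2 * e] of the matching with the 2 for moving both birth and death. *)
have mp : `|maxpers D1 - maxpers D2| <= 4 * Num.sqrt M.+1%:R * Delta * S.
  by apply: le_trans (matched_maxpers m) _; rewrite /e; lra.
split=> //.
- exact: hausdorff_le.
- by have := matched_bottleneck m; rewrite /e !mulrA.
have s3 : 0 < Num.sqrt 3 :> R by rewrite sqrtr_gt0.
rewrite /score1 /score2 -mulrBl normrM (gtr0_norm (x := (Num.sqrt 3)^-1)) ?invr_gt0 //.
rewrite sqrtrM ?ler0n // sqrtrV ?ler0n // ler_pdivrMr //.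
apply: le_trans mp _; rewrite le_eqVlt; apply/orP; left; apply/eqP.
by field; rewrite gt_eqF.
Qed.
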